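(* Let $\varphi=\forall\pi_1\cdots\forall\pi_n.\psi$ be a universally quantified HyperTSL formula, let $T_P$ and $T_U$ be the sets of predicate terms and update terms occurring in $\varphi$, and let $AP_{in}=\{a_\tau:\tau\in T_P\}$, $AP_{out}=\{a_u:u\in T_U\}$. If the HyperLTL formula $\mathrm{transl}(\varphi)$ over $AP_{in}\,\dot\cup\,AP_{out}$ is realizable, then $\varphi$ is realizable.
   Context: TSL setting. Let $\mathcal V$ be a set of values containing the Booleans $\mathbb B$. Fix a set $\mathbb I$ of inputs, a finite set $\mathbb C$ of cells, function symbols $\Sigma_F$ (with arities) and predicate symbols $\Sigma_P\subseteq\Sigma_F$. Function terms: $\tau::=s\mid f\,\tau_1\cdots\tau_n$, $s\in\mathbb I\cup\mathbb C$, $f\in\Sigma_F$ $n$-ary; $\mathcal T_F$ is their set. Predicate terms: $p\,\tau_1\cdots\tau_n$, $p\in\Sigma_P$. Update terms: $[c\leftarrow\tau]$, $c\in\mathbb C$. An interpretation $\langle\cdot\rangle$ maps each $n$-ary symbol to a function $\mathcal V^n\to\mathcal V$ (predicate symbols to maps into $\mathbb B$). Cell assignments are total maps $\mathbb C\to\mathcal T_F$, forming the set $\mathcal C$; computations are $\varsigma\in\mathcal C^\omega$; input streams are $\iota\in\mathcal I^\omega$, $\mathcal I$ the set of maps $\mathbb I\to\mathcal V$; executions are pairs $(\varsigma,\iota)$. Each cell $c$ has an initial value $\mathrm{init}_c$. Evaluation: $\eta(\varsigma,\iota,i,s)=\iota(i)(s)$ for $s\in\mathbb I$; $=\mathrm{init}_s$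 for $s\in\mathbb C$, $i=0$; $=\eta(\varsigma,\iota,i-1,\varsigma(i-1)(s))$ for $s\in\mathbb C$, $i>0$; $\eta(\varsigma,\iota,i,f\tau_1\cdots\tau_n)=\langle f\rangle(\eta(\varsigma,\iota,i,\tau_1),\dots)$. HyperTSL: $\varphi::=\forall\pi.\varphi\mid\exists\pi.\varphi\mid\psi$, $\psi::=\neg\psi\mid\psi\wedge\psi\mid X\psi\mid\psi U\psi\mid(\tau^p)_\pi\mid[c\leftarrow\tau]_\pi$. Over a set $E$ of executions, assignment $\Pi$ of trace variables to $E$, interpretation and time $i$: $[c\leftarrow\tau]_\pi$ holds iff $\varsigma(i)(c)$ is syntactically $\tau$ for $(\varsigma,\iota)=\Pi(\pi)$; $(\tau^p)_\pi$ holds iff $\eta(\varsigma,\iota,i,\tau^p)$ is true; Boolean and temporal operators as in LTL ($X$: next step; $U$: until); quantifiers range over $E$. $E\models_{\langle\cdot\rangle}\varphi$ iff $\varphi$ holds at time $0$ with empty assignment. HyperTSL realizability: a strategy is $\sigma:(2^{T_P})^+\to\mathcal C$; for an interpretation and input stream $\iota$, the computation $\sigma(\iota)$ is given by $\sigma(\iota)(i)=\sigma(P_0\cdots P_i)$ with $P_j=\{\tau\in T_P:\eta(\sigma(\iota),\iota,j,\tau)\text{ true}\}$ (well defined since $\eta$ at time $j$ depends only on $\sigma(\iota)(0..j-1)$). $\varphi$ is realizable iff some strategy $\sigma$ satisfies $\{(\sigma(\iota),\iota):\iota\in\mathcal I^\omega\}\models_{\langle\cdot\rangle}\varphi$ for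 every interpretation $\langle\cdot\rangle$. HyperLTL: over $AP$, traces in $(2^{AP})^\omega$, formulas $\forall\pi/\exists\pi$ prefixes over LTL bodies with atoms $a_\pi$ ($a\in\Pi(\pi)(i)$); $T\models\varphi$ for a trace set $T$ as usual. With $AP=AP_{in}\dot\cup AP_{out}$, a HyperLTL strategy is $\sigma:(2^{AP_{in}})^+\to 2^{AP_{out}}$, $\mathit{traces}(\sigma)=\{(w_0\cup\sigma(w_0))(w_1\cup\sigma(w_0w_1))\cdots : w\in(2^{AP_{in}})^\omega\}$; a HyperLTL formula is realizable iff some strategy has $\mathit{traces}(\sigma)\models\varphi$. Translation: for each term $\tau\in T_P\cup T_U$ a fresh proposition $a_\tau$. With $T_U^c$ the update terms of $T_U$ for cell $c$, $\mathit{cellProps}_\pi:=G\bigwedge_{c\in\mathbb C}\bigvee_{u\in T_U^c}((a_u)_\pi\wedge\bigwedge_{u'\in T_U^c\setminus\{u\}}\neg(a_{u'})_\pi)$ ($G$ = globally). For $\varphi=Q_1\pi_1\cdots Q_n\pi_n.\psi$, $\mathrm{transl}(\varphi)=Q_1\pi_1\cdots Q_n\pi_n.\psi'\wedge\bigwedge_j\mathit{cellProps}_{\pi_j}$ where $\psi'$ replaces each $(\tau)_\pi$ by $(a_\tau)_\pi$. *)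

(* Defs.v *)
From HB Require Import structures.
From mathcomp Require Import all_boot.
From mathcomp Require Import boolp classical_sets.

Set Implicit Arguments.
Unset Strict Implicit.
Unset Printing Implicit Defensive.

Local Open Scope classical_set_scope.

(** * Words *)

(* A^+, presented as a first letter followed by a possibly empty word. *)
Definition word1 (A : Type) : Type := (A * seq A)%type.

(* The nonempty finite word w_0 w_1 ... w_i. *)
Definition word_upto (A : Type) (w : nat -> A) (i : nat) : word1 A :=
  (w 0, [seq w j | j <- iota 1 i]).

(** * Quantifier prefixes, shared by HyperTSL and HyperLTL *)

(* Trace variables are named by natural numbers. [B] is the type of
   quantifier-free bodies. *)
Inductive hyper (B : Type) : Type :=
| HAll of nat & hyper B
| HEx of nat & hyper B
| HBody of B.

Fixpoint universal (B : Type) (phi : hyper B) : Prop :=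
  match phi with
  | HAll _ phi' => universal phi'
  | HEx _ _ => False
  | HBody _ => True
  end.

Fixpoint qvars (B : Type) (phi : hyper B) : seq nat :=
  match phi with
  | HAll x phi' | HEx x phi' => x :: qvars phi'
  | HBody _ => [::]
  end.

Fixpoint body_of (B : Type) (phi : hyper B) : B :=
  match phi with
  | HAll _ phi' | HEx _ phi' => body_of phi'
  | HBody b => b
  end.

Fixpoint map_body (B B' : Type) (g : B -> B') (phi : hyper B) : hyper B' :=
  match phi with
  | HAll x phi' => HAll x (map_body g phi')
  | HEx x phi' => HEx x (map_body g phi')
  | HBody b => HBody (g b)
  end.

(* Partial assignments of trace variables to elements of M. *)
Definition assignment (M : Type) : Type := nat -> option M.

Definition empty_asg (M : Type) : assignment M := fun=> None.

Definition asg_set (M : Type) (Pi : assignment M) (x : nat) (m : M) :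
  assignment M := fun y => if y == x then Some m else Pi y.

(* The atom is false at an unassigned variable; this never happens when a
   closed formula is evaluated from the empty assignment. *)
Definition at_var (M : Type) (Pi : assignment M) (x : nat) (P : M -> Prop) :
  Prop := if Pi x is Some m then P m else False.

(* Satisfaction of a quantified formula over the set E; bsat is the
   satisfaction of bodies at a given time. *)
Fixpoint hyper_sat (B M : Type) (bsat : assignment M -> nat -> B -> Prop)
    (E : set M) (Pi : assignment M) (phi : hyper B) : Prop :=
  match phi with
  | HAll x phi' => forall m, E m -> hyper_sat bsat E (asg_set Pi x m) phi'
  | HEx x phi' => exists2 m, E m & hyper_sat bsat E (asg_set Pi x m) phi'
  | HBody b => bsat Pi 0 b
  end.

(** * TSL terms *)

Record tsl_sig : Type := TslSig {
  input : Type;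
  cell : finType;
  fsym : Type;
  arity : fsym -> nat;
  is_psym : pred fsym
}.

Inductive fterm (S : tsl_sig) : Type :=
| TInput of input S
| TCell of cell S
| TApp (f : fsym S) of ('I_(arity f) -> fterm S).
Arguments TInput {S}.
Arguments TCell {S}.
Arguments TApp {S}.

Record pterm (S : tsl_sig) : Type := PTerm {
  psym_of : fsym S;
  psym_ofP : is_psym psym_of;
  pargs : 'I_(arity psym_of) -> fterm S
}.

Definition fterm_of_pterm (S : tsl_sig) (t : pterm S) : fterm S :=
  TApp (psym_of t) (@pargs S t).

Record uterm (S : tsl_sig) : Type := UTerm {
  ucell : cell S;
  uval : fterm S
}.

(* Classical decidable (Leibniz, i.e. syntactic) equality on terms. *)
HB.instance Definition _ (S : tsl_sig) := gen_eqMixin (pterm S).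
HB.instance Definition _ (S : tsl_sig) := gen_eqMixin (uterm S).

(** * Values, interpretations, executions, evaluation *)

Record value_set : Type := ValueSet {
  value :> Type;
  vbool : bool -> value;
  vbool_inj : injective vbool
}.
Arguments vbool : clear implicits.

Record interpretation (S : tsl_sig) (V : value_set) : Type := Interp {
  interp :> forall f : fsym S, ('I_(arity f) -> V) -> V;
  interp_psym : forall (p : fsym S) (a : 'I_(arity p) -> V),
    is_psym p -> exists b : bool, interp a = vbool V b
}.

Arguments interp {S V} _ f _.

Definition cell_assignment (S : tsl_sig) : Type := cell S -> fterm S.
Definition computation (S : tsl_sig) : Type := nat -> cell_assignment S.
Definition input_stream (S : tsl_sig) (V : value_set) : Type :=
  nat -> input S -> V.
Definition execution (S : tsl_sig) (V : value_set) : Type :=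
  (computation S * input_stream S V)%type.

Section Evaluation.
Variables (S : tsl_sig) (V : value_set).
Variables (init : cell S -> V) (J : interpretation S V).

Fixpoint eval (s : computation S) (io : input_stream S V) (i : nat) :
    fterm S -> V :=
  fix ev (t : fterm S) : V :=
    match t with
    | TInput x => io i x
    | TCell c => if i is j.+1 then eval s io j (s j c) else init c
    | TApp f a => J f (fun k => ev (a k))
    end.

Definition pholds (s : computation S) (io : input_stream S V) (i : nat)
  (t : pterm S) : Prop := eval s io i (fterm_of_pterm t) = vbool V true.

Lemma eval_agree (s s' : computation S) (io : input_stream S V) (i : nat) :
  (forall j, j < i -> s j = s' j) -> eval s io i = eval s' io i.
Proof.
elim: i => [|i IH] ss'; apply/funext; elim=> [x|c|f a IHa] //=.
- by rewrite ss' // IH // => j ji; apply: ss'; apply: leq_trans ji _.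
- by congr (interp J f _); apply/funext => k; exact: IHa.
Qed.

End Evaluation.

(** * HyperTSL *)

Inductive tsl_body (S : tsl_sig) : Type :=
| TNot of tsl_body S
| TAnd of tsl_body S & tsl_body S
| TNext of tsl_body S
| TUntil of tsl_body S & tsl_body S
| TPred of pterm S & nat
| TUpd of uterm S & nat.

Definition hypertsl (S : tsl_sig) : Type := hyper (tsl_body S).

Fixpoint tsl_vars (S : tsl_sig) (p : tsl_body S) : seq nat :=
  match p with
  | TNot p1 | TNext p1 => tsl_vars p1
  | TAnd p1 p2 | TUntil p1 p2 => tsl_vars p1 ++ tsl_vars p2
  | TPred _ x | TUpd _ x => [:: x]
  end.

Definition tsl_closed (S : tsl_sig) (phi : hypertsl S) : Prop :=
  {subset tsl_vars (body_of phi) <= qvars phi}.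

Fixpoint body_pterms (S : tsl_sig) (p : tsl_body S) : seq (pterm S) :=
  match p with
  | TNot p1 | TNext p1 => body_pterms p1
  | TAnd p1 p2 | TUntil p1 p2 => body_pterms p1 ++ body_pterms p2
  | TPred t _ => [:: t]
  | TUpd _ _ => [::]
  end.

Fixpoint body_uterms (S : tsl_sig) (p : tsl_body S) : seq (uterm S) :=
  match p with
  | TNot p1 | TNext p1 => body_uterms p1
  | TAnd p1 p2 | TUntil p1 p2 => body_uterms p1 ++ body_uterms p2
  | TPred _ _ => [::]
  | TUpd u _ => [:: u]
  end.

Definition pterms (S : tsl_sig) (phi : hypertsl S) : seq (pterm S) :=
  undup (body_pterms (body_of phi)).

Definition uterms (S : tsl_sig) (phi : hypertsl S) : seq (uterm S) :=
  undup (body_uterms (body_of phi)).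

Definition T_P (S : tsl_sig) (phi : hypertsl S) : set (pterm S) :=
  [set t | t \in pterms phi].

Definition T_U (S : tsl_sig) (phi : hypertsl S) : set (uterm S) :=
  [set u | u \in uterms phi].

Section HyperTSL_semantics.
Variables (S : tsl_sig) (V : value_set).
Variables (init : cell S -> V) (J : interpretation S V).

Fixpoint tsl_sat (Pi : assignment (execution S V)) (i : nat)
    (p : tsl_body S) : Prop :=
  match p with
  | TNot p1 => ~ tsl_sat Pi i p1
  | TAnd p1 p2 => tsl_sat Pi i p1 /\ tsl_sat Pi i p2
  | TNext p1 => tsl_sat Pi i.+1 p1
  | TUntil p1 p2 => exists j, [/\ i <= j, tsl_sat Pi j p2
                    & forall k, i <= k < j -> tsl_sat Pi k p1]
  | TPred t x => at_var Pi x (fun e => pholds init J e.1 e.2 i t)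
  | TUpd u x => at_var Pi x (fun e => e.1 i (ucell u) = uval u)
  end.

Definition hypertsl_models (E : set (execution S V)) (phi : hypertsl S) :
  Prop := hyper_sat tsl_sat E (@empty_asg _) phi.

End HyperTSL_semantics.

(** * HyperTSL realizability *)

(* For A : set T, the coercion of A to a type is the subtype of its elements,
   so that [set A] is the powerset 2^A. *)
Definition tsl_strategy (S : tsl_sig) (TP : set (pterm S)) : Type :=
  word1 (set TP) -> cell_assignment S.

Section Strategy_computation.
Variables (S : tsl_sig) (V : value_set).
Variables (init : cell S -> V) (J : interpretation S V).
Variables (TP : set (pterm S)).

(* The set P_j of the predicate terms in TP which are true at time j. *)
Definition pred_stream (s : computation S) (io : input_stream S V)
  (j : nat) : set TP := [set t | pholds init J s io j (val t)].

Variables (sigma : tsl_strategy TP) (io : input_stream S V).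

(* Iteration of s |-> (i |-> sigma(P_0 ... P_i)), from an arbitrary
   computation; the first n entries of the n-th iterate are final. *)
Fixpoint strat_iter (n : nat) : computation S :=
  if n is m.+1 then
    fun i => sigma (word_upto (pred_stream (strat_iter m) io) i)
  else fun _ c => TCell c.

Definition strat_comp : computation S := fun i => strat_iter i.+1 i.

Lemma word_upto_agree (s s' : computation S) (i : nat) :
  (forall j, j < i -> s j = s' j) ->
  word_upto (pred_stream s io) i = word_upto (pred_stream s' io) i.
Proof.
move=> ss'; have E k : k <= i -> pred_stream s io k = pred_stream s' io k.
  move=> ki; rewrite /pred_stream /pholds (@eval_agree _ _ _ _ s s') // => j jk.
  by apply: ss'; apply: leq_trans ki.
rewrite /word_upto E //; congr pair; apply/eq_in_map => j.
by rewrite mem_iota add1n ltnS => /andP[_ ji]; apply: E.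
Qed.

Lemma strat_iter_stable (m n i : nat) :
  i < m -> i < n -> strat_iter m i = strat_iter n i.
Proof.
elim: m n i => [|m IH] [|n] i //; rewrite !ltnS => im jn /=.
by congr sigma; apply: word_upto_agree => j ji; apply: IH;
  apply: leq_trans ji _.
Qed.

Definition follows_strategy (s : computation S) : Prop :=
  forall i, s i = sigma (word_upto (pred_stream s io) i).

Lemma strat_compP : follows_strategy strat_comp.
Proof.
move=> i; rewrite {1}/strat_comp /=; congr sigma.
by apply: word_upto_agree => j ji; apply: strat_iter_stable.
Qed.

Lemma strat_comp_unique (s : computation S) :
  follows_strategy s -> s = strat_comp.
Proof.
move=> sP; apply/funext => i; elim/ltn_ind: i => i IH.
by rewrite sP strat_compP; congr sigma; apply: word_upto_agree.
Qed.

End Strategy_computation.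

Definition tsl_realizable (S : tsl_sig) (V : value_set) (init : cell S -> V)
    (phi : hypertsl S) : Prop :=
  exists sigma : tsl_strategy (T_P phi), forall J : interpretation S V,
    hypertsl_models init J
      [set (strat_comp init J sigma io, io) | io in [set: input_stream S V]]
      phi.

(** * HyperLTL *)

Inductive ltl_body (AP : Type) : Type :=
| LTrue
| LNot of ltl_body AP
| LAnd of ltl_body AP & ltl_body AP
| LNext of ltl_body AP
| LUntil of ltl_body AP & ltl_body AP
| LAtom of AP & nat.
Arguments LTrue {AP}.

Definition LFalse {AP : Type} : ltl_body AP := LNot LTrue.

Definition LOr (AP : Type) (p q : ltl_body AP) : ltl_body AP :=
  LNot (LAnd (LNot p) (LNot q)).

Definition LGlobally (AP : Type) (p : ltl_body AP) : ltl_body AP :=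
  LNot (LUntil LTrue (LNot p)).

Definition LConj (AP : Type) (ps : seq (ltl_body AP)) : ltl_body AP :=
  foldr (@LAnd AP) LTrue ps.

Definition LDisj (AP : Type) (ps : seq (ltl_body AP)) : ltl_body AP :=
  foldr (@LOr AP) LFalse ps.

Definition hyperltl (AP : Type) : Type := hyper (ltl_body AP).

Definition trace (AP : Type) : Type := nat -> set AP.

Fixpoint ltl_sat (AP : Type) (Pi : assignment (trace AP)) (i : nat)
    (p : ltl_body AP) : Prop :=
  match p with
  | LTrue => True
  | LNot p1 => ~ ltl_sat Pi i p1
  | LAnd p1 p2 => ltl_sat Pi i p1 /\ ltl_sat Pi i p2
  | LNext p1 => ltl_sat Pi i.+1 p1
  | LUntil p1 p2 => exists j, [/\ i <= j, ltl_sat Pi j p2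
                    & forall k, i <= k < j -> ltl_sat Pi k p1]
  | LAtom a x => at_var Pi x (fun t => t i a)
  end.

Definition hyperltl_models (AP : Type) (T : set (trace AP))
  (phi : hyperltl AP) : Prop :=
  hyper_sat (@ltl_sat AP) T (@empty_asg _) phi.

Section HyperLTL_realizability.
Variables (AP : Type) (APin APout : set AP).

Definition ltl_strategy : Type := word1 (set APin) -> set APout.

Definition traces (sigma : ltl_strategy) : set (trace AP) :=
  [set (fun i => (val @` w i) `|` (val @` sigma (word_upto w i)))
  | w in [set: nat -> set APin]].

Definition ltl_realizable (phi : hyperltl AP) : Prop :=
  exists sigma : ltl_strategy, hyperltl_models (traces sigma) phi.

End HyperLTL_realizability.

(** * Translation *)

(* The fresh proposition a_t is [inl t] for a predicate term and [inr u] for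
   an update term; this makes AP_in and AP_out disjoint. *)
Definition tsl_ap (S : tsl_sig) : Type := (pterm S + uterm S)%type.

Definition AP_in (S : tsl_sig) (phi : hypertsl S) : set (tsl_ap S) :=
  [set (inl t : tsl_ap S) | t in T_P phi].

Definition AP_out (S : tsl_sig) (phi : hypertsl S) : set (tsl_ap S) :=
  [set (inr u : tsl_ap S) | u in T_U phi].

(* TU enumerates the update terms under consideration. *)
Definition cellProps (S : tsl_sig) (TU : seq (uterm S)) (x : nat) :
    ltl_body (tsl_ap S) :=
  let TUc (c : cell S) := [seq u <- TU | ucell u == c] in
  LGlobally (LConj [seq
    LDisj [seq
      LAnd (LAtom (inr u : tsl_ap S) x)
           (LConj [seq LNot (LAtom (inr u' : tsl_ap S) x)
                  | u' <- TUc c & u' != u])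
    | u <- TUc c]
  | c <- enum (cell S)]).

Fixpoint transl_body (S : tsl_sig) (p : tsl_body S) : ltl_body (tsl_ap S) :=
  match p with
  | TNot p1 => LNot (transl_body p1)
  | TAnd p1 p2 => LAnd (transl_body p1) (transl_body p2)
  | TNext p1 => LNext (transl_body p1)
  | TUntil p1 p2 => LUntil (transl_body p1) (transl_body p2)
  | TPred t x => LAtom (inl t : tsl_ap S) x
  | TUpd u x => LAtom (inr u : tsl_ap S) x
  end.

Definition transl (S : tsl_sig) (phi : hypertsl S) : hyperltl (tsl_ap S) :=
  map_body (fun psi => LAnd (transl_body psi)
                       (LConj [seq cellProps (uterms phi) x | x <- qvars phi]))
    phi.

(* Main.v *)
Require Import Defs.
From mathcomp Require Import all_boot.
From mathcomp Require Import boolp classical_sets.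

(** A HyperLTL strategy for the translation reads valuations of the predicate
    terms and selects update propositions, so it becomes a HyperTSL strategy by
    assigning to each cell the first update term selected for it.  Running it
    on an input stream and recording the predicate terms that hold yields a
    trace of the HyperLTL strategy; as all quantifiers are universal, that trace
    satisfies the translated body.  In particular it satisfies [cellProps], so
    exactly one update is selected per cell, and the update propositions of the
    trace are exactly the updates performed by the computation.  Hence the trace
    and the execution agree on every atom of the body. *)

Set Implicit Arguments.
Unset Strict Implicit.
Unset Printing Implicit Defensive.

Local Open Scope classical_set_scope.

Section LTL_connectives.
Variables (AP : Type) (Pi : assignment (trace AP)).

Lemma ltl_sat_globally (i : nat) (p : ltl_body AP) :
  ltl_sat Pi i (LGlobally p) -> forall j, i <= j -> ltl_sat Pi j p.
Proof.
(* A failure of [p] at time [j] would witness the until that [LGlobally] negates. *)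
move=> H j ij; apply: contrapT => Hj; apply: H.
by exists j; split.
Qed.

Lemma ltl_sat_conj_map (T : eqType) (i : nat) (f : T -> ltl_body AP)
    (s : seq T) :
  ltl_sat Pi i (LConj [seq f x | x <- s]) ->
  forall x, x \in s -> ltl_sat Pi i (f x).
Proof.
elim: s => [|y s IH] //= [Hy Hs] x; rewrite inE => /orP[/eqP->//|].
exact: IH.
Qed.

Lemma ltl_sat_disj_map (T : eqType) (i : nat) (f : T -> ltl_body AP)
    (s : seq T) :
  ltl_sat Pi i (LDisj [seq f x | x <- s]) ->
  exists2 x, x \in s & ltl_sat Pi i (f x).
Proof.
elim: s => [|y s IH] /= H; first by case: H.
have [Hy|Hy] := pselect (ltl_sat Pi i (f y)); first by exists y; rewrite ?mem_head.
have [|x xs Hx] := IH; last by exists x => //; rewrite inE xs orbT.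
by apply: contrapT => Hs; apply: H.
Qed.

End LTL_connectives.

Lemma ltl_sat_cellProps (S : tsl_sig) (TU : seq (uterm S)) (x i : nat)
    (Pi : assignment (trace (tsl_ap S))) (t : trace (tsl_ap S)) :
  Pi x = Some t -> ltl_sat Pi i (cellProps TU x) ->
  forall (j : nat) (c : cell S), i <= j ->
  exists u, [/\ u \in TU, ucell u = c, t j (inr u)
    & forall u', u' \in TU -> ucell u' = c -> t j (inr u') -> u' = u].
Proof.
move=> Pix H j c ij.
have /ltl_sat_conj_map/(_ c) := ltl_sat_globally H ij.
rewrite mem_enum => /(_ isT)/ltl_sat_disj_map[u].
rewrite mem_filter => /andP[/eqP uc uTU] /= [].
rewrite /at_var Pix => tu /ltl_sat_conj_map Hu; exists u; split=> // u' u'TU u'c tu'.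
apply/eqP; apply: contrapT => /negP u'u.
have /Hu : u' \in [seq u' <- [seq u0 <- TU | ucell u0 == c] | u' != u].
  by rewrite !mem_filter u'u u'c eqxx.
by rewrite /= /at_var Pix.
Qed.

(* Two families of models with a common index set are compared one assignment of
   indices at a time; only universal prefixes allow this. *)
Lemma universal_hyper_sat_map (I B B' M M' : Type)
    (bsat : assignment M -> nat -> B -> Prop)
    (bsat' : assignment M' -> nat -> B' -> Prop)
    (f : I -> M) (f' : I -> M') (T : set M') (g : B -> B') (phi : hyper B)
    (A : assignment I) :
  universal phi -> (forall i, T (f' i)) ->
  (forall A' : assignment I, bsat' (fun x => omap f' (A' x)) 0 (g (body_of phi)) ->
    bsat (fun x => omap f (A' x)) 0 (body_of phi)) ->
  hyper_sat bsat' T (fun x => omap f' (A x)) (map_body g phi) ->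
  hyper_sat bsat [set f i | i in [set: I]] (fun x => omap f (A x)) phi.
Proof.
have asg_set_map N (h : I -> N) C x i :
    asg_set (fun y => omap h (C y)) x (h i) = fun y => omap h (asg_set C x i y).
  by apply/funext => y; rewrite /asg_set; case: (y == x).
elim: phi A => [x phi IH|x phi IH|b] A //= uphi Tf' bb'; last exact: bb'.
move=> H m [i _ <-]; rewrite asg_set_map; apply: IH => //.
by rewrite -asg_set_map; apply: H.
Qed.

(** Agreement is required only on terms and variables occurring in [p]: other terms have no
    proposition in the alphabet, and [cellProps] constrains only quantified variables. *)
Lemma tsl_sat_transl (S : tsl_sig) (V : value_set) (init : cell S -> V)
    (J : interpretation S V) (Pi : assignment (execution S V))
    (Pi' : assignment (trace (tsl_ap S))) (p : tsl_body S) :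
  (forall t x i, t \in body_pterms p -> x \in tsl_vars p ->
    tsl_sat init J Pi i (TPred t x) <-> ltl_sat Pi' i (LAtom (inl t) x)) ->
  (forall u x i, u \in body_uterms p -> x \in tsl_vars p ->
    tsl_sat init J Pi i (TUpd u x) <-> ltl_sat Pi' i (LAtom (inr u) x)) ->
  forall i, tsl_sat init J Pi i p <-> ltl_sat Pi' i (transl_body p).
Proof.
elim: p => [p IH|p IHp q IHq|p IH|p IHp q IHq|t x|u x] /= HP HU.
1,3: by move=> i; rewrite IH.
1,2: have {}IHp : forall i, tsl_sat init J Pi i p <-> ltl_sat Pi' i (transl_body p)
  by apply: IHp => [t|u] x i tp xp; [apply: HP|apply: HU]; rewrite mem_cat ?tp ?xp.
1,2: have {}IHq : forall i, tsl_sat init J Pi i q <-> ltl_sat Pi' i (transl_body q)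
  by apply: IHq => [t|u] x i tp xp; [apply: HP|apply: HU]; rewrite mem_cat ?tp ?xp orbT.
- by move=> i; rewrite IHp IHq.
- move=> i; split=> -[j [ij /IHq qj pk]]; exists j; split=> // k /pk;
    by rewrite IHp.
- by move=> i; apply: HP; rewrite mem_head.
- by move=> i; apply: HU; rewrite mem_head.
Qed.

Section Strategy_transfer.
Variables (S : tsl_sig) (phi : hypertsl S).

(** Comparing underlying values avoids building elements of the subtype [AP_in phi]. *)
Definition lift_preds (P : set (T_P phi)) : set (AP_in phi) :=
  [set a | exists2 t, P t & val a = inl (val t)].

Lemma lift_predsE (P : set (T_P phi)) (t : T_P phi) :
  (val @` lift_preds P) (inl (val t)) <-> P t.
Proof.
split=> [[a [t' Pt' ->]] [/val_inj <-]//|Pt].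
have tin : inl (val t) \in AP_in phi by apply/mem_set; exists (val t) => //; exact: set_valP.
by exists (Sub (inl (val t)) tin); [exists t; rewrite ?SubK|rewrite SubK].
Qed.

Definition lift_word (w : word1 (set (T_P phi))) : word1 (set (AP_in phi)) :=
  (lift_preds w.1, map lift_preds w.2).

Lemma lift_word_upto (w : nat -> set (T_P phi)) (i : nat) :
  lift_word (word_upto w i) = word_upto (lift_preds \o w) i.
Proof. by rewrite /lift_word /word_upto /= -map_comp. Qed.

(* A cell for which no update is selected keeps its value. *)
Definition selected_update (out : set (AP_out phi)) (c : cell S) : uterm S :=
  head (UTerm c (TCell c))
    [seq u <- uterms phi | (ucell u == c) && `[< (val @` out) (inr u) >]].

Lemma selected_updateP (out : set (AP_out phi)) (c : cell S) (u : uterm S) :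
  u \in uterms phi -> ucell u = c -> (val @` out) (inr u) ->
  (forall u', u' \in uterms phi -> ucell u' = c -> (val @` out) (inr u') ->
    u' = u) ->
  selected_update out c = u.
Proof.
move=> uU uc outu uniq_u; rewrite /selected_update.
set s := filter _ _.
have us : u \in s by rewrite mem_filter uU uc eqxx andbT; apply/asboolP.
(* As [u] lies in [s], [head] does not fall back on its default. *)
have : head (UTerm c (TCell c)) s \in s.
  by case: s us => // a s _; rewrite mem_head.
rewrite mem_filter => /andP[/andP[/eqP hc /asboolP outh] hU].
exact: uniq_u.
Qed.

Variable sigma : ltl_strategy (AP_in phi) (AP_out phi).

Definition tsl_strategy_of_ltl : tsl_strategy (T_P phi) :=
  fun w c => uval (selected_update (sigma (lift_word w)) c).

Variables (V : value_set) (init : cell S -> V) (J : interpretation S V).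

Definition run (io : input_stream S V) : computation S :=
  strat_comp init J tsl_strategy_of_ltl io.

(** The word fed to [sigma] is read off the run that [sigma] itself drives; this is not circular,
    since predicates at time [j] depend only on earlier updates. *)
Definition run_preds (io : input_stream S V) : nat -> set (AP_in phi) :=
  @lift_preds \o pred_stream init J (run io) io.

Definition run_trace (io : input_stream S V) : trace (tsl_ap S) :=
  fun i => (val @` run_preds io i) `|`
           (val @` sigma (word_upto (run_preds io) i)).

Lemma traces_run_trace (io : input_stream S V) : traces sigma (run_trace io).
Proof. by exists (run_preds io). Qed.

Lemma run_trace_pred (io : input_stream S V) (i : nat) (t : pterm S) :
  t \in pterms phi -> run_trace io i (inl t) <-> pholds init J (run io) io i t.
Proof.
move=> tP; have tT : t \in T_P phi by apply/mem_set.
rewrite /run_trace; split=> [[|[a _ at_]]|Ht].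
- by move/(lift_predsE _ (Sub t tT)).
(* Outputs are all of the form [inr], so they contribute no predicate proposition. *)
- by have [u _ ua] := set_valP a; rewrite -ua in at_.
- by left; apply/(lift_predsE _ (Sub t tT)).
Qed.

Lemma run_trace_update (io : input_stream S V) (i : nat) (u : uterm S) :
  run_trace io i (inr u) <->
  (val @` sigma (word_upto (run_preds io) i)) (inr u).
Proof.
split=> [[[a _ au]|//]|]; last by right.
by have [t _ ta] := set_valP a; rewrite -ta in au.
Qed.

Lemma runE (io : input_stream S V) (i : nat) (c : cell S) :
  run io i c = uval (selected_update (sigma (word_upto (run_preds io) i)) c).
Proof. by rewrite /run strat_compP /tsl_strategy_of_ltl lift_word_upto. Qed.

(** The unique [v] is the update that the run performs on this cell, so both sides amount to
    [u = v]. *)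
Lemma run_update_iff (io : input_stream S V) (i : nat) (u : uterm S) :
  u \in uterms phi ->
  (exists v, [/\ v \in uterms phi, ucell v = ucell u, run_trace io i (inr v)
    & forall v', v' \in uterms phi -> ucell v' = ucell u ->
        run_trace io i (inr v') -> v' = v]) ->
  run io i (ucell u) = uval u <-> run_trace io i (inr u).
Proof.
move=> uU [v [vU vu tv uniq_v]].
rewrite runE (@selected_updateP _ _ v) //; last 2 first.
- exact/run_trace_update.
- by move=> v' v'U v'u /run_trace_update; apply: uniq_v.
split=> [vuE|/(uniq_v _ uU erefl)-> //].
(* An update term is determined by its cell and its assigned term. *)
suff -> : u = v by [].
by case: u v vu vuE {uU vU tv uniq_v} => [c t] [c' t'] /= -> ->.
Qed.

End Strategy_transfer.

Theorem theorem1 (S : tsl_sig) (V : value_set) (init : cell S -> V)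
    (phi : hypertsl S) (phi_closed : tsl_closed phi)
    (phi_universal : universal phi) :
  ltl_realizable (AP_in phi) (AP_out phi) (transl phi) ->
  tsl_realizable init phi.
Proof.
move=> [sigma sigmaP]; exists (tsl_strategy_of_ltl sigma) => J.
(* Input streams index both the executions and the matching traces. *)
apply: (@universal_hyper_sat_map _ _ _ _ _ _ (@ltl_sat _)
  (fun io => (run sigma init J io, io)) (run_trace sigma init J)
  (traces sigma) _ phi (@empty_asg _) phi_universal
  (@traces_run_trace _ _ _ _ _ _) _ sigmaP) => A /= [Hbody Hcells].
(* At an unassigned variable both atoms are false. *)
apply: (proj2 (tsl_sat_transl _ _ 0)) Hbody => [t x i tp _|u x i up xp] /=;
  rewrite /at_var; case Ax: (A x) => [io|] //=.
- by rewrite run_trace_pred // mem_undup.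
- apply: run_update_iff; first by rewrite mem_undup.
  (* Closedness makes [x] a quantified variable, so its [cellProps] is among the conjuncts. *)
  have Hx := ltl_sat_conj_map Hcells (phi_closed _ xp).
  by apply: ltl_sat_cellProps Hx _ _ _ => //; rewrite Ax.
Qed.
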